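(* For each integer $d \geq 1$ let $X$ be the simple random walk on the $d$-dimensional hypercube $\{0,1\}^d$ and let $n = 2^d$. Then, as $d \to \infty$, the optimal transport time satisfies $$H(\mu,\nu) \leq (1+o(1))\,n$$ for all probability distributions $\mu,\nu$ on $\{0,1\}^d$; that is, there is a sequence $\varepsilon_d \to 0$, not depending on $\mu,\nu$, such that $H(\mu,\nu) \leq (1+\varepsilon_d)2^d$ for every $d\geq 1$ and all probability distributions $\mu,\nu$ on $\{0,1\}^d$.
   Context: The simple random walk on the $d$-dimensional hypercube is the discrete-time Markov chain on $\{0,1\}^d$ which at each step chooses one of the $d$ coordinates uniformly at random, say $x_j$, and changes it to $1-x_j$. For probability distributions $\mu,\nu$ on the state space, the optimal transport time (also called access time) is $H(\mu,\nu) := \inf_{T} \mathbb{E}[T]$, where $X_0 \sim \mu$ and the infimum is over all almost surely finite, possibly randomized, stopping times $T$ of $X$ such that $X_T \sim \nu$. (A randomized stopping time is a stopping time with respect to a filtration $\mathcal{F}_t = \sigma(U, X_0,\dots,X_t)$, where $U$ is uniform on $[0,1]$ and independent of $X$.) *)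

(* Defs.v *)
From HB Require Import structures.
From mathcomp Require Import all_boot all_order all_algebra.
From mathcomp Require Import all_classical all_reals all_analysis.
Import Order.TTheory GRing.Theory Num.Theory.
Import numFieldNormedType.Exports.

Set Implicit Arguments.
Unset Strict Implicit.
Unset Printing Implicit Defensive.

Local Open Scope classical_set_scope.
Local Open Scope ring_scope.

(* {0,1}^d with the discrete sigma-algebra, so that [probability (cube d) R]
   is the type of all probability distributions on {0,1}^d. *)
Definition cube (d : nat) : Type := {ffun 'I_d -> bool}.

HB.instance Definition _ (d : nat) := Finite.on (cube d).
HB.instance Definition _ (d : nat) :=
  isPointed.Build (cube d) [ffun _ => false].
HB.instance Definition _ (d : nat) :=
  @isMeasurable.Build default_measure_display (cube d) discrete_measurable
    discrete_measurable0 discrete_measurableC discrete_measurableU.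

Definition flip (d : nat) (x : cube d) (j : 'I_d) : cube d :=
  [ffun i => if i == j then ~~ x i else x i].

(* Probability that flipping a uniformly chosen coordinate leads from x to y. *)
Definition srw_kernel (R : realType) (d : nat) (x y : cube d) : R :=
  #|[set j : 'I_d | flip x j == y]%SET|%:R / d%:R.

Section Processes.
Context {R : realType} {d : nat} {disp : measure_display}.
Context {Omega : measurableType disp} (P : probability Omega R).
Implicit Types (X : nat -> {mfun Omega >-> cube d}) (U : {mfun Omega >-> R}).

Definition path_event X (t : nat) (xs : nat -> cube d) : set Omega :=
  [set w | forall s, (s <= t)%N -> X s w = xs s].

(* The Markov property is written multiplicatively, which avoids conditioning
   on null events. *)
Definition is_srw (mu : probability (cube d) R) X : Prop :=
  (forall A : set (cube d), distribution P (X 0%N) A = mu A) /\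
  (forall (t : nat) (xs : nat -> cube d),
     P (path_event X t.+1 xs) =
     (P (path_event X t xs) * (srw_kernel R (xs t) (xs t.+1))%:E)%E).

Definition sigma_process X : set (set Omega) :=
  <<s \bigcup_t g_sigma_algebra_preimage (X t) >>.

Definition independent_uniform X U : Prop :=
  (forall B : set R, measurable B ->
     distribution P U B = uniform_prob (@ltr01 R) B) /\
  (forall A B : set Omega,
     g_sigma_algebra_preimage U A -> sigma_process X B ->
     P (A `&` B) = (P A * P B)%E).

Definition filtration U X (t : nat) : set (set Omega) :=
  <<s g_sigma_algebra_preimage U `|`
      \bigcup_(s in [set s | (s <= t)%N]) g_sigma_algebra_preimage (X s) >>.

(* A random time takes values in [option nat], with [None] for infinity. *)
Implicit Types T : Omega -> option nat.

Definition is_stopping_time U X T : Prop :=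
  forall t : nat,
    filtration U X t [set w | exists2 s, T w = Some s & (s <= t)%N].

Definition ae_finite T : Prop := {ae P, forall w, T w <> None}.

Definition stops_with_law X T (nu : probability (cube d) R) : Prop :=
  forall A : set (cube d),
    P [set w | exists2 t, T w = Some t & A (X t w)] = nu A.

Definition expected_time T : \bar R :=
  (\int[P]_w (if T w is Some t then t%:R%:E else +oo))%E.

End Processes.

(* The infimum ranges over T and over the realizations (Omega, P, X, U) of the
   walk and its independent uniform variable; T is a function of (U, X), whose
   joint law is determined by mu, so the choice of realization is immaterial. *)
Definition access_time (R : realType) (d : nat)
    (mu nu : probability (cube d) R) : \bar R :=
  ereal_inf [set h : \bar R |
    exists (disp : measure_display) (Omega : measurableType disp)
           (P : probability Omega R) (X : nat -> {mfun Omega >-> cube d})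
           (U : {mfun Omega >-> R}) (T : Omega -> option nat),
      [/\ is_srw P mu X,
          independent_uniform P X U,
          is_stopping_time U X T,
          ae_finite P T /\ stops_with_law P X T nu
        & h = expected_time P T]].

(* Main.v *)
From HB Require Import structures.
Require Import Defs.
From mathcomp Require Import all_boot all_order all_algebra.
From mathcomp Require Import all_classical all_reals all_analysis.
From mathcomp Require Import measurable_realfun ring lra.
Import Order.TTheory GRing.Theory Num.Theory.
Import numFieldNormedType.Exports.

Set Implicit Arguments.
Unset Strict Implicit.
Unset Printing Implicit Defensive.

Local Open Scope classical_set_scope.
Local Open Scope ring_scope.

(** The optimal transport time never exceeds the largest expected hitting time
    of a point: use the uniform variable to draw a target [y] with law [nu],
    independently of the walk, and stop when the walk first visits [y]. The
    stopped walk sits at [y], hence has law [nu], and conditionally on the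
    starting point and on [y] the expected waiting time is an expected hitting
    time between two vertices.

    On the hypercube, the Hamming distance to [y] is a birth and death chain,
    which moves from [k] to [k - 1] with probability [k / d] and to [k + 1] with
    probability [(d - k) / d]. The expected time to come from distance [k + 1]
    to distance [k] is the ratio of the number of vertices at distance more than
    [k] to ['C(d - 1, k)]. Summing over [k], the hitting time from the antipode
    is at most [2 ^ d] times [\sum_k 1 / 'C(d - 1, k) - 1 + 2 ^- d]. This factor
    tends to [1], because the sum of the inverses of the binomial coefficients of
    a row is asymptotically that of its two extreme terms, namely [2]
    (lemma [inv_binomial_sum_le]). This gives the error term [13 / d].

    As the finiteness of the expected hitting time is itself part of the claim,
    it is the truncated sums of the tails [P(T > t)] that are compared with
    the explicit solution [hitting_bound] of the first-step equations, by
    induction on the truncation (lemma [sum_survival_le]).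

    The probability space carrying the walk is a product of three factors: the
    unit interval for the target, the cube with law [mu] for the starting point,
    and another copy of the unit interval, whose base [d] digits are the
    successive coordinates to flip. The digits are independent and uniform
    because the shift of the expansion preserves Lebesgue measure and is
    independent of the first digit (lemma [uniform_quantile_rescale]). *)

(** * Sums of inverses of binomial coefficients, and the distance chain *)

Section Comb.
Variable R : realFieldType.

Definition inv_binomial_sum (m : nat) : R := \sum_(i < m.+1) ('C(m, i)%:R)^-1.

Lemma bin_neq0 (m i : nat) : (i <= m)%N -> 'C(m, i)%:R != 0 :> R.
Proof. by move=> im; rewrite pnatr_eq0 -lt0n bin_gt0. Qed.

(** Both coefficients are ['C(m, i)] times [m + 1] over an integer, and these two
    integers add up to [m + 2]. *)
Lemma inv_bin_pair (m i : nat) : (i <= m)%N ->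
  ('C(m.+1, i)%:R)^-1 + ('C(m.+1, i.+1)%:R)^-1
  = (m.+2%:R / m.+1%:R) * ('C(m, i)%:R)^-1 :> R.
Proof.
move=> im.
have C0 := bin_neq0 im.
have m0 : m.+1%:R != 0 :> R by rewrite pnatr_eq0.
have e1 : m.+1%:R * 'C(m, i)%:R = i.+1%:R * 'C(m.+1, i.+1)%:R :> R.
  by rewrite -!natrM; congr (_ %:R); exact: mul_bin_diag.
have e2 : m.+1%:R * 'C(m, i)%:R = (m.+1%:R - i%:R) * 'C(m.+1, i)%:R :> R.
  by rewrite -natrB ?leqW// -!natrM -mul_bin_down.
have C1 : 'C(m.+1, i)%:R != 0 :> R by apply: bin_neq0; exact: leqW.
have C2 : 'C(m.+1, i.+1)%:R != 0 :> R by exact: bin_neq0.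
have -> : ('C(m.+1, i)%:R)^-1 = (m.+1%:R - i%:R) / (m.+1%:R * 'C(m, i)%:R) :> R.
  by apply: (mulIf C1); rewrite mulVf// mulrAC -e2 divff// mulf_neq0.
have -> : ('C(m.+1, i.+1)%:R)^-1 = i.+1%:R / (m.+1%:R * 'C(m, i)%:R) :> R.
  by apply: (mulIf C2); rewrite mulVf// mulrAC -e1 divff// mulf_neq0.
rewrite -(natr1 m.+1) -(natr1 i); field.
by rewrite C0 nat1r.
Qed.

(** Write twice the sum of row [m + 1], once without its last term and once
    without its first one, and pair the remaining terms. *)
Lemma inv_binomial_sumS (m : nat) :
  inv_binomial_sum m.+1 = 1 + m.+2%:R / (2 * m.+1%:R) * inv_binomial_sum m.
Proof.
have e1 : inv_binomial_sum m.+1 = \sum_(i < m.+1) ('C(m.+1, i)%:R)^-1 + 1.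
  by rewrite /inv_binomial_sum big_ord_recr /= binn invr1.
have e2 : inv_binomial_sum m.+1 = 1 + \sum_(i < m.+1) ('C(m.+1, i.+1)%:R)^-1.
  by rewrite /inv_binomial_sum big_ord_recl /= bin0 invr1.
have e3 : \sum_(i < m.+1) ('C(m.+1, i)%:R)^-1
      + \sum_(i < m.+1) ('C(m.+1, i.+1)%:R)^-1
    = (m.+2%:R / m.+1%:R) * inv_binomial_sum m.
  rewrite -big_split /= mulr_sumr; apply: eq_bigr => i _.
  by rewrite inv_bin_pair// -ltnS.
have m0 : m.+1%:R != 0 :> R by rewrite pnatr_eq0.
have -> : m.+2%:R / (2 * m.+1%:R) * inv_binomial_sum m =
   2^-1 * (m.+2%:R / m.+1%:R * inv_binomial_sum m).
  by field; rewrite nat1r.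
by rewrite -e3; lra.
Qed.

(** At each step the recursion multiplies the excess over [2] by about [1 / 2],
    and adds [1 / (m + 1)] to it, so that a bound by [c / (m + 1)] propagates for
    [c] large enough; [c = 12] is the least constant for which it does so from
    [m = 2] on. *)
Lemma inv_binomial_sum_le (m : nat) :
  inv_binomial_sum m <= 2 + 12 / m.+1%:R.
Proof.
have s0 : inv_binomial_sum 0 = 1.
  by rewrite /inv_binomial_sum big_ord1 bin0 invr1.
have s1 : inv_binomial_sum 1 = 2 by rewrite inv_binomial_sumS s0; lra.
(* The induction step only works from row 2 on. *)
case: m => [|]; first by rewrite s0; lra.
case=> [|]; first by rewrite s1; lra.
elim=> [|m IH]; first by rewrite inv_binomial_sumS s1; lra.
rewrite inv_binomial_sumS.
have m0 : 0 <= m%:R :> R by exact: ler0n.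
have E k : (m + k)%:R = m%:R + k%:R :> R by exact: natrD.
move: IH; rewrite -[m.+4]addn4 -[m.+3]addn3 !E => IH.
set x := m%:R in m0 IH *.
have x3 : 0 < x + 3 by lra.
have x4 : 0 < x + 4 by lra.
apply: (@le_trans _ _ (1 + (x + 4) / (2 * (x + 3)) * (2 + 12 / (x + 3)))).
  rewrite lerD2l ler_wpM2l// divr_ge0//; lra.
rewrite -subr_ge0.
have -> : 2 + 12 / (x + 4) - (1 + (x + 4) / (2 * (x + 3)) * (2 + 12 / (x + 3)))
  = (5 * x ^+ 2 + 17 * x) / ((x + 3) ^+ 2 * (x + 4)).
  field; lra.
apply: divr_ge0; first nra.
apply: mulr_ge0; [exact: sqr_ge0 | lra].
Qed.

Definition binomial_tail (m k : nat) : nat := \sum_(k <= j < m.+2) 'C(m.+1, j).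

(** Expected time that the distance to the target of the walk on the cube of
    dimension [m + 1] takes to go from [k + 1] to [k]: the ratio of the stationary
    mass beyond [k] to the stationary flow along this edge. *)
Definition crossing_time (m k : nat) : R :=
  (binomial_tail m k.+1)%:R / 'C(m, k)%:R.

(** Expected hitting time of a vertex at Hamming distance [k]. *)
Definition hitting_bound (m k : nat) : R := \sum_(i < k) crossing_time m i.

Lemma binomial_tail_le (m k : nat) : (binomial_tail m k <= 2 ^ m.+1)%N.
Proof.
have -> : (2 ^ m.+1 = \sum_(0 <= j < m.+2) 'C(m.+1, j))%N.
  rewrite big_mkord -[2%N]/(1 + 1)%N expnDn.
  by apply: eq_bigr => i _; rewrite !exp1n !muln1.
have [km|km] := leqP k m.+2.
  by rewrite [leqRHS](big_cat_nat (n := k))//= leq_addl.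
by rewrite /binomial_tail big_geq// ltnW.
Qed.

Lemma crossing_time_ge0 m k : 0 <= crossing_time m k.
Proof. by rewrite divr_ge0. Qed.

(** First-step equation for [crossing_time], multiplied by [m + 1]: its
    terms are [m + 1] times consecutive tails, or their difference, over the same
    coefficient ['C(m + 1, k + 1)]. For [k = m] the last term vanishes with its
    factor [m - k]. *)
Lemma crossing_timeS (m k : nat) : (k <= m)%N ->
  k.+1%:R * crossing_time m k
  = m.+1%:R + (m - k)%:R * crossing_time m k.+1.
Proof.
move=> km; rewrite /crossing_time.
have C0 := bin_neq0 km.
have C1 : 'C(m.+1, k.+1)%:R != 0 :> R by exact: bin_neq0.
have e1 : m.+1%:R * 'C(m, k)%:R = k.+1%:R * 'C(m.+1, k.+1)%:R :> R.
  by rewrite -!natrM; congr (_ %:R); exact: mul_bin_diag.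
have e2 : m.+1%:R * 'C(m, k.+1)%:R = (m - k)%:R * 'C(m.+1, k.+1)%:R :> R.
  by rewrite -!natrM; congr (_ %:R); exact: mul_bin_down.
have -> : binomial_tail m k.+1 = ('C(m.+1, k.+1) + binomial_tail m k.+2)%N.
  by rewrite /binomial_tail big_ltn.
have f1 : k.+1%:R / 'C(m, k)%:R = m.+1%:R / 'C(m.+1, k.+1)%:R :> R.
  by apply/eqP; rewrite eqr_div// e1.
rewrite mulrCA f1 natrD mulrDl mulrCA divff// mulr1; congr (_ + _).
move: km; rewrite leq_eqVlt => /orP[/eqP ->|km].
  by rewrite subnn /binomial_tail big_geq// !mul0r.
have C2 := bin_neq0 km.
have f2 : (m - k)%:R / 'C(m, k.+1)%:R = m.+1%:R / 'C(m.+1, k.+1)%:R :> R.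
  by apply/eqP; rewrite eqr_div// e2.
by rewrite [RHS]mulrCA f2.
Qed.

Lemma hitting_bound_rec (m k : nat) : (k <= m)%N ->
  m.+1%:R * hitting_bound m k.+1
  = m.+1%:R + k.+1%:R * hitting_bound m k + (m - k)%:R * hitting_bound m k.+2.
Proof.
move=> km.
have -> : hitting_bound m k.+2 = hitting_bound m k.+1 + crossing_time m k.+1.
  by rewrite /hitting_bound big_ord_recr.
have -> : hitting_bound m k = hitting_bound m k.+1 - crossing_time m k.
  by rewrite /hitting_bound big_ord_recr /= addrK.
rewrite mulrBr mulrDr (crossing_timeS km).
have -> : m.+1%:R = k.+1%:R + (m - k)%:R :> R by rewrite -natrD addSn subnKC.
ring.
Qed.

Lemma hitting_bound_ge0 m k : 0 <= hitting_bound m k.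
Proof. by apply: sumr_ge0 => i _; exact: crossing_time_ge0. Qed.

Lemma hitting_bound_homo m k l : (k <= l)%N ->
  hitting_bound m k <= hitting_bound m l.
Proof.
move=> kl; rewrite /hitting_bound -!(big_mkord xpredT (crossing_time m)).
rewrite [leRHS](big_cat_nat (n := k))//= lerDl.
by apply: sumr_ge0 => i _; exact: crossing_time_ge0.
Qed.

(** The tails are bounded by [2 ^ (m + 1)], except in the last term, which is
    exactly [1]: with that bound it would contribute another [2 ^ (m + 1)]. *)
Lemma hitting_bound_max m :
  hitting_bound m m.+1
  <= (1 + ((2 ^+ m.+1)^-1 + inv_binomial_sum m - 2)) * 2 ^+ m.+1.
Proof.
rewrite /hitting_bound /inv_binomial_sum !big_ord_recr /= binn invr1.
set S := \sum_(i < m) _; set T := \sum_(i < m) _.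
have -> : crossing_time m m = 1.
  by rewrite /crossing_time binn /binomial_tail big_nat1 binn divr1.
have p0 : 2 ^+ m.+1 != 0 :> R by rewrite expf_neq0 ?pnatr_eq0.
have -> : (1 + ((2 ^+ m.+1)^-1 + (T + 1) - 2)) * 2 ^+ m.+1
  = 2 ^+ m.+1 * T + 1 by field.
rewrite lerD2r mulr_sumr; apply: ler_sum => i _.
rewrite ler_wpM2r ?invr_ge0 ?ler0n//.
by rewrite -natrX ler_nat binomial_tail_le.
Qed.

Lemma hitting_bound_asymp m :
  hitting_bound m m.+1 <= (1 + 13 / m.+1%:R) * 2 ^+ m.+1.
Proof.
rewrite (le_trans (hitting_bound_max m))//.
rewrite ler_wpM2r ?exprn_ge0// lerD2l.
have : (2 ^+ m.+1)^-1 <= m.+1%:R^-1 :> R.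
  by rewrite lef_pV2 ?posrE ?exprn_gt0// -natrX ler_nat ltnW// ltn_expl.
have := inv_binomial_sum_le m.
set p := (2 ^+ _)^-1; set q := m.+1%:R^-1; lra.
Qed.
End Comb.

(** * The Hamming distance along the walk *)

Section Hamming.
Variable d : nat.
Implicit Types x y : cube d.

Definition hamming x y : nat := #|[pred i | x i != y i]|.

Lemma hamming_le x y : (hamming x y <= d)%N.
Proof. by rewrite -[leqRHS]card_ord max_card. Qed.

Lemma hamming_gt0 x y : (0 < hamming x y)%N = (x != y).
Proof.
apply/card_gt0P/idP => [[i]|xy].
  by rewrite inE; apply: contraNneq => ->.
apply/existsP; rewrite -[[exists _, _]]negbK negb_exists.
apply: contra xy => /forallP h.
by apply/eqP/ffunP => i; move: (h i); rewrite negbK => /eqP.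
Qed.

Lemma hamming_flip x y j :
  hamming (flip x j) y
  = if x j != y j then (hamming x y).-1 else (hamming x y).+1.
Proof.
rewrite /hamming; case: ifPn => xyj.
  rewrite [in RHS](cardD1 j) inE xyj add1n /=; apply: eq_card => i.
  rewrite !inE ffunE; case: (eqVneq i j) => [->|ij]//=.
  by case: (x j) (y j) xyj => -[].
rewrite (cardD1 j) inE ffunE eqxx.
have -> /= : ~~ x j != y j by case: (x j) (y j) xyj => -[].
rewrite add1n; congr _.+1; apply: eq_card => i.
rewrite !inE ffunE; case: (eqVneq i j) => [->|ij]//=.
exact/esym/negbTE.
Qed.

End Hamming.

(** [hitting_bound] solves the first-step equation of expected hitting times:
    among the coordinates, those in which [x] and [y] differ bring the walk
    closer to [y], the others take it away. *)
Lemma hitting_bound_first_step (R : realFieldType) m (x y : cube m.+1) : x != y ->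
  1 + (\sum_j hitting_bound R m (hamming (flip x j) y)) / m.+1%:R
  = hitting_bound R m (hamming x y).
Proof.
rewrite -hamming_gt0.
have -> : \sum_j hitting_bound R m (hamming (flip x j) y)
  = (hamming x y)%:R * hitting_bound R m (hamming x y).-1
  + (m.+1 - hamming x y)%:R * hitting_bound R m (hamming x y).+1.
  rewrite (bigID (fun j => x j != y j)) /=; congr (_ + _).
    rewrite (eq_bigr (fun=> hitting_bound R m (hamming x y).-1)).
      by rewrite sumr_const mulr_natl.
    by move=> j xyj; rewrite hamming_flip xyj.
  rewrite (eq_bigr (fun=> hitting_bound R m (hamming x y).+1)).
    rewrite sumr_const mulr_natl; congr (_ *+ _).
    have := cardC [pred j | x j != y j]; rewrite card_ord.
    by move/(congr1 (subn^~ (hamming x y))); rewrite /= addKn => <-.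
  by move=> j xyj; rewrite hamming_flip (negbTE xyj).
have := hamming_le x y; case: (hamming x y) => // k km _.
rewrite subSS/=.
have d0 : m.+1%:R != 0 :> R by rewrite pnatr_eq0.
apply: (mulfI d0); rewrite hitting_bound_rec//.
rewrite mulrDr mulr1 mulrCA divff// mulr1; ring.
Qed.

(** * Uniform points, their cells and their digits *)

Section Uniform.
Variable R : realType.
Local Notation leb := (@lebesgue_measure R).
Local Notation unif := (uniform_prob (@ltr01 R)).

Lemma uniform_prob01E (A : set R) : measurable A ->
  unif A = leb (A `&` `]0, 1]%classic).
Proof.
move=> mA; rewrite /uniform_prob integral_uniform_pdf.
rewrite (eq_integral (fun=> 1%E)); last first.
  move=> x; rewrite inE => -[_]; rewrite /= in_itv /= /uniform_pdf => ->.
  by rewrite subr0 invr1.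
rewrite integral_cst ?mul1e//=; last exact: measurableI.
have -> : `[(0:R), 1]%classic = [set 0] `|` `]0, 1]%classic.
  by rewrite setU1itv// bnd_simp.
rewrite setIUr measureU//; last 3 first.
- exact: measurableI.
- exact: measurableI.
- rewrite predeqE => x; split => // -[[_ /= ->]] [_]/=.
  by rewrite in_itv/= ltxx.
rewrite [X in (X + _)%E](_ : _ = 0%E) ?add0e//.
apply/eqP; rewrite eq_le measure_ge0 andbT.
rewrite -(lebesgue_measure_set1 (0:R)) le_measure ?inE//; exact: measurableI.
Qed.

(** Both sides are measures in [B] which agree on half-open intervals. *)
Lemma lebesgue_measure_affine (a r : R) (B : set R) : 0 < r -> measurable B ->
  leb ((fun v => (v - a) / r) @^-1` B) = (r%:E * leb B)%E.
Proof.
move=> r0 mB.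
pose f : R -> measurableTypeR R := fun v => (v - a) / r.
have mf : measurable_fun setT f.
  by apply: measurable_funM => //; exact: measurable_funB.
have ri : 0 <= r^-1 by rewrite invr_ge0 ltW.
pose m : {measure set (measurableTypeR R) -> \bar R} :=
  mscale (NngNum ri) (pushforward leb f).
have E : forall X, ocitv X -> leb X = m mf X.
  move=> _ [[b c]] _ <-; rewrite /m /= /mscale /= /pushforward.
  rewrite (_ : f @^-1` _ = `]b * r + a, c * r + a]%classic); last first.
    apply/funext => v; apply/propext; rewrite /= !in_itv /=.
    by rewrite /f ltr_pdivlMr// ler_pdivrMr// ltrBrDr lerBlDr.
  rewrite !lebesgue_measure_itv /= !lte_fin ltrD2r ltr_pM2r//.
  case: ifPn => // _; last by rewrite mule0.
  rewrite -!EFinB -EFinM; congr (_ %:E); field; exact: lt0r_neq0.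
rewrite (lebesgue_measure_unique E mB) /m /= /mscale /= muleA -EFinM divff ?mul1e//.
exact: lt0r_neq0.
Qed.

End Uniform.

Section Quantile.
Variables (R : realType) (n : nat) (p : 'I_n.+1 -> R).
Hypotheses (p_ge0 : forall i, 0 <= p i) (p_sum : \sum_i p i = 1).
Local Notation leb := (@lebesgue_measure R).
Local Notation unif := (uniform_prob (@ltr01 R)).

Definition cumul (k : nat) : R := \sum_(j < n.+1 | (j < k)%N) p j.

Definition cell (i : 'I_n.+1) : set R := `]cumul i, cumul i.+1]%classic.

(** The cells cut the interval (0, 1] into consecutive intervals of lengths
    [p i], so that the index of the cell of a uniform point has law [p]. The
    default value only matters on a null set. *)
Definition quantile (v : R) : 'I_n.+1 :=
  odflt ord0 [pick i : 'I_n.+1 | cumul i < v <= cumul i.+1].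

Lemma cumul_homo : {homo cumul : k l / (k <= l)%N >-> k <= l}.
Proof.
move=> k l kl; rewrite /cumul big_mkcond [leRHS]big_mkcond /=.
apply: ler_sum => j _; case: ifPn => [jk|_]; first by rewrite (leq_trans jk).
by case: ifPn.
Qed.

Lemma cumul0 : cumul 0 = 0.
Proof. by rewrite /cumul big_pred0. Qed.

Lemma cumul_full : cumul n.+1 = 1.
Proof. by rewrite -p_sum; apply: eq_bigl => j; rewrite ltn_ord. Qed.

Lemma cumulS (i : 'I_n.+1) : cumul i.+1 = cumul i + p i.
Proof.
rewrite /cumul (bigD1 i) ?ltnS//= addrC; congr (_ + _).
by apply: eq_bigl => j; rewrite ltnS [RHS]ltn_neqAle andbC.
Qed.

Lemma cell_sub i : cell i `<=` `]0, 1]%classic.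
Proof.
move=> v; rewrite /cell /= !in_itv/= => /andP[a b].
rewrite (le_lt_trans _ a) -?cumul0 ?cumul_homo//=.
by rewrite (le_trans b)// -cumul_full cumul_homo.
Qed.

Lemma cell_inj i j v : cell i v -> cell j v -> i = j.
Proof.
rewrite /cell /= !in_itv/= => /andP[a b] /andP[a' b']; apply/val_inj/eqP.
by rewrite eqn_leq; apply/andP; split; rewrite leqNgt; apply/negP => /cumul_homo;
  rewrite leNgt => /negP; apply; [exact: lt_le_trans a b'|exact: lt_le_trans a' b].
Qed.

Lemma cell_cover v : `]0, 1]%classic v -> exists i, cell i v.
Proof.
rewrite /= in_itv/= => /andP[v0 v1].
have ex : exists k, v <= cumul k by exists n.+1; rewrite cumul_full.
case: (ex_minnP ex) => -[|k] vk kmin; first by move: vk; rewrite cumul0 leNgt v0.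
have kn : (k < n.+1)%N by apply: kmin; rewrite cumul_full.
exists (Ordinal kn); rewrite /cell /= in_itv/= vk andbT ltNge.
by apply/negP => /kmin; rewrite ltnn.
Qed.

Lemma quantile_cell i v : cell i v -> quantile v = i.
Proof.
rewrite /quantile => vi; case: pickP => [j vj|/(_ i)] /=.
  by apply: (cell_inj _ vi); rewrite /cell /= in_itv.
by move: vi; rewrite /cell/= in_itv/= => ->.
Qed.

Lemma quantile_out v : ~ `]0, 1]%classic v -> quantile v = ord0.
Proof.
move=> v01; rewrite /quantile; case: pickP => [j vj|//]; exfalso; apply: v01.
by apply: (@cell_sub j); rewrite /cell /= in_itv.
Qed.

Lemma measurable_cell i : measurable (cell i).
Proof. exact: measurable_itv. Qed.

Lemma quantileE i : quantile @^-1` [set i] =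
  cell i `|` (if i == ord0 then ~` `]0, 1]%classic else set0).
Proof.
apply/seteqP; split => v /=.
  move=> <-; have [v01|v01] := pselect (`]0, 1]%classic v).
    by have [j vj] := cell_cover v01; left; rewrite (quantile_cell vj).
  by right; rewrite quantile_out// eqxx.
case=> [/quantile_cell//|]; case: ifPn => // /eqP ->; exact: quantile_out.
Qed.

Lemma measurable_quantile i : measurable (quantile @^-1` [set i]).
Proof.
rewrite quantileE; apply: measurableU; first exact: measurable_cell.
by case: ifPn => // _; exact: measurableC.
Qed.

Lemma uniform_quantileI i (B : set R) :
  measurable (quantile @^-1` [set i] `&` B) ->
  unif (quantile @^-1` [set i] `&` B) = leb (cell i `&` B).
Proof.
move=> mB; rewrite uniform_prob01E//; congr (leb _).
rewrite -setIA (setIC B) setIA; congr (_ `&` _); apply/seteqP; split => v.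
  by case=> <- /cell_cover[j vj]; rewrite (quantile_cell vj).
by move=> vi; split; [exact: quantile_cell|exact: cell_sub vi].
Qed.

Lemma uniform_quantile i : unif (quantile @^-1` [set i]) = (p i)%:E.
Proof.
rewrite -[_ @^-1` _]setIT uniform_quantileI; last first.
  by rewrite setIT; exact: measurable_quantile.
rewrite setIT /cell lebesgue_measure_itv/= lte_fin -EFinB cumulS ltrDl.
rewrite addrAC subrr add0r.
case: ifPn => //; rewrite -leNgt => pi; congr EFin; apply/esym/eqP.
by rewrite eq_le pi p_ge0.
Qed.

(** The affine map of each cell of positive length onto (0, 1]. For equal weights,
    [quantile] is the first digit of the expansion and [rescale] is the shift of
    the expansion (with the convention that expansions do not end in zeros). *)
Definition rescale (v : R) : R := (v - cumul (quantile v)) / p (quantile v).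

Lemma quantile_rescaleE i (B : set R) :
  quantile @^-1` [set i] `&` rescale @^-1` B
  = quantile @^-1` [set i] `&` (fun v => (v - cumul i) / p i) @^-1` B.
Proof. by apply/seteqP; split => v /= [<-]. Qed.

Lemma measurable_quantile_rescale i (B : set R) : measurable B ->
  measurable (quantile @^-1` [set i] `&` rescale @^-1` B).
Proof.
move=> mB; rewrite quantile_rescaleE.
apply: measurableI; first exact: measurable_quantile.
rewrite -[_ @^-1` _]setTI.
have : measurable_fun setT (fun v : R => (v - cumul i) / p i).
  by apply: measurable_funM => //; exact: measurable_funB.
exact.
Qed.

(** A uniform point has a uniform position in its cell, independently of the
    cell: this is what makes successive digits independent. *)
Lemma uniform_quantile_rescale i (B : set R) : 0 < p i -> measurable B ->
  unif (quantile @^-1` [set i] `&` rescale @^-1` B) = ((p i)%:E * unif B)%E.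
Proof.
move=> pi mB; have mBi := measurable_quantile_rescale i mB.
rewrite quantile_rescaleE in mBi *.
rewrite uniform_quantileI// uniform_prob01E//.
rewrite -(lebesgue_measure_affine (cumul i))//; last exact: measurableI.
congr (leb _); rewrite preimage_setI setIC; congr (_ `&` _).
apply/funext => v; apply/propext; rewrite /cell /= !in_itv/= cumulS.
by rewrite ltr_pdivlMr// mul0r subr_gt0 ler_pdivrMr// mul1r lerBlDl.
Qed.

End Quantile.

(** * The walk driven by the digits of a uniform point *)

Section Walk.
Variables (R : realType) (m : nat).
Local Notation unif := (uniform_prob (@ltr01 R)).
Implicit Types (x y : cube m.+1) (v : R).

Definition digit : R -> 'I_m.+1 := quantile (fun=> m.+1%:R^-1).
Definition digit_shift : R -> R := rescale (fun _ : 'I_m.+1 => m.+1%:R^-1).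

Let weight_ge0 (i : 'I_m.+1) : 0 <= m.+1%:R^-1 :> R.
Proof. by rewrite invr_ge0. Qed.

Let weight_sum : \sum_(i < m.+1) m.+1%:R^-1 = 1 :> R.
Proof. by rewrite sumr_const card_ord -[LHS]mulr_natl divff// pnatr_eq0. Qed.

Lemma first_digit_setE (B : 'I_m.+1 -> set R) :
  [set v | B (digit v) (digit_shift v)]
  = \big[setU/set0]_j (digit @^-1` [set j] `&` digit_shift @^-1` B j).
Proof.
rewrite -bigcup_seq; apply/seteqP; split => v /=.
  by move=> h; exists (digit v) => //=; exact: mem_index_enum.
by case=> j _ [<-].
Qed.

Lemma measurable_first_digit (B : 'I_m.+1 -> set R) :
  (forall j, measurable (B j)) ->
  measurable [set v | B (digit v) (digit_shift v)].
Proof.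
move=> mB; rewrite first_digit_setE; apply: bigsetU_measurable => j _.
exact: measurable_quantile_rescale.
Qed.

(** First-step analysis: after the first digit, the remaining ones form again a
    uniform sequence, so conditioning on the first digit averages over it. *)
Lemma uniform_first_digit (B : 'I_m.+1 -> set R) (b : 'I_m.+1 -> R) :
  (forall j, measurable (B j)) -> (forall j, unif (B j) = (b j)%:E) ->
  unif [set v | B (digit v) (digit_shift v)] = ((\sum_j b j) / m.+1%:R)%:E.
Proof.
move=> mB bE; rewrite first_digit_setE measure_bigsetU_ord//=; last 2 first.
- by move=> j; exact: measurable_quantile_rescale.
- by move=> i j _ _ [v [[<- _] [<- _]]].
rewrite mulrC mulr_sumr -sumEFin; apply: eq_bigr => j _.
by rewrite uniform_quantile_rescale// bE.
Qed.

(** The recursion removes the first step and not the last one, so that events of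
    the walk up to time [t + 1] have the form treated by first-step analysis. *)
Fixpoint walk (t : nat) x v : cube m.+1 :=
  if t is t'.+1 then walk t' (flip x (digit v)) (digit_shift v) else x.

Lemma measurable_walk t x (A : set (cube m.+1)) : measurable (walk t x @^-1` A).
Proof.
elim: t x => [|t IH] x /=.
  by have [Ax|Ax] := pselect (A x);
    [rewrite preimage_cst mem_set|rewrite preimage_cst memNset].
exact: (measurable_first_digit (B := fun j => walk t (flip x j) @^-1` A)).
Qed.

Definition walk_path x t (xs : nat -> cube m.+1) : set R :=
  [set v | forall s, (s <= t)%N -> walk s x v = xs s].

Lemma measurable_walk_path x t xs : measurable (walk_path x t xs).
Proof.
rewrite (_ : walk_path x t xs = \bigcap_(s in [set s | (s <= t)%N])
    walk s x @^-1` [set xs s]); last by apply/seteqP; split.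
by apply: bigcap_measurable => [|s _]; [exists 0%N|exact: measurable_walk].
Qed.

Lemma walk_pathS x t xs : x = xs 0%N -> walk_path x t.+1 xs =
  [set v | (if flip x (digit v) == xs 1%N
            then walk_path (xs 1%N) t (xs \o succn) else set0) (digit_shift v)].
Proof.
move=> x0; apply/seteqP; split => v /=.
  by move=> h; have /= <- := h 1%N isT; rewrite eqxx => s st; exact: (h s.+1).
case: eqP => // h hs [|s] st /=; first by [].
by rewrite h; exact: hs.
Qed.

Lemma uniform_walk_path t xs :
  unif (walk_path (xs 0%N) t xs)
  = (\prod_(0 <= s < t) srw_kernel R (xs s) (xs s.+1))%:E.
Proof.
elim: t xs => [|t IH] xs.
  rewrite big_geq// (_ : walk_path _ _ _ = setT) ?probability_setT//.
  by apply/seteqP; split => // v _ s; rewrite leqn0 => /eqP ->.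
rewrite walk_pathS//.
pose B j : set R := if flip (xs 0%N) j == xs 1%N
  then walk_path (xs 1%N) t (xs \o succn) else set0.
rewrite (uniform_first_digit (B := B)
  (b := fun j => if flip (xs 0%N) j == xs 1%N then
     \prod_(0 <= s < t) srw_kernel R (xs s.+1) (xs s.+2) else 0)); last 2 first.
- by move=> j; rewrite /B; case: ifP => _ //; exact: measurable_walk_path.
- move=> j; rewrite /B; case: ifP => _; last exact: measure0.
  exact: (IH (xs \o succn)).
rewrite big_nat_recl// -big_mkcond/= sumr_const -[X in X / _]mulr_natl mulrAC.
by rewrite /srw_kernel cardsE.
Qed.

Definition walk_avoids x y t : set R :=
  [set v | forall s, (s <= t)%N -> walk s x v <> y].

Lemma measurable_walk_avoids x y t : measurable (walk_avoids x y t).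
Proof.
rewrite (_ : walk_avoids x y t = \bigcap_(s in [set s | (s <= t)%N])
    walk s x @^-1` (~` [set y])); last by apply/seteqP; split.
by apply: bigcap_measurable => [|s _]; [exists 0%N|exact: measurable_walk].
Qed.

(** Probability that the walk from [x] misses [y] up to time [t]. *)
Fixpoint survival (t : nat) x y : R :=
  if x == y then 0
  else if t is t'.+1 then (\sum_j survival t' (flip x j) y) / m.+1%:R else 1.

Lemma uniform_walk_avoids t x y :
  unif (walk_avoids x y t) = (survival t x y)%:E.
Proof.
elim: t x => [|t IH] x /=; case: eqVneq => [<-|xy].
- by rewrite (_ : walk_avoids _ _ _ = set0) ?measure0// -subset0 => v /(_ 0%N isT).
- rewrite (_ : walk_avoids _ _ _ = setT) ?probability_setT//.
  by apply/seteqP; split => // v _ s; rewrite leqn0 => /eqP -> /= /eqP; apply/negP.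
- by rewrite (_ : walk_avoids _ _ _ = set0) ?measure0// -subset0 => v /(_ 0%N isT).
rewrite (_ : walk_avoids _ _ _ =
    [set v | walk_avoids (flip x (digit v)) y t (digit_shift v)]).
  by rewrite (uniform_first_digit (B := fun j => walk_avoids (flip x j) y t)
    (b := fun j => survival t (flip x j) y))// => j; exact: measurable_walk_avoids.
apply/seteqP; split => v /=; first by move=> h s st; exact: (h s.+1).
by move=> h [|s] st /=; [move/eqP; apply/negP|exact: h].
Qed.

(** The left-hand side is the expectation of the hitting time truncated at [N].
    It satisfies the first-step equation of [hitting_bound] with the truncation
    lowered by one on the right, and so it stays below [hitting_bound]. *)
Lemma sum_survival_le N x y :
  \sum_(t < N) survival t x y <= hitting_bound R m (hamming x y).
Proof.
elim: N x => [|N IH] x; first by rewrite big_ord0 hitting_bound_ge0.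
have [<-|xy] := eqVneq x y.
  by rewrite big1 ?hitting_bound_ge0// => t _; case: t => -[|t] /= _; rewrite eqxx.
rewrite -hitting_bound_first_step// big_ord_recl /= (negbTE xy) lerD2l.
rewrite -mulr_suml ler_wpM2r ?invr_ge0// exchange_big /=.
exact: ler_sum.
Qed.

End Walk.

(** * A realization of the walk with an independent uniform variable *)

Lemma enum_cube d : exists n (e : 'I_n.+1 -> cube d), bijective e.
Proof.
have c0 : (0 < #|{: cube d}|)%N by apply/card_gt0P; exists [ffun=> false].
exists #|{: cube d}|.-1, (enum_val \o cast_ord (prednK c0)).
apply: bij_comp; first exact: enum_val_bij.
by exists (cast_ord (esym (prednK c0))) => i; [exact: cast_ordK|exact: cast_ordKV].
Qed.

(** Compose an enumeration of the cube with the quantile function of the weights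
    that [nu] gives to the enumerated vertices. *)
Lemma sampling_exists (R : realType) d (nu : probability (cube d) R) :
  exists q : R -> cube d, (forall A, measurable (q @^-1` A)) /\
    forall A, uniform_prob (@ltr01 R) (q @^-1` A) = nu A.
Proof.
have [n [e [e' eK e'K]]] := enum_cube d.
pose p i := fine (nu [set e i]).
have AE A : A = \big[setU/set0]_(i < n.+1 | e i \in A) [set e i].
  rewrite -bigcup_seq_cond; apply/seteqP; split => y /=.
    by move=> Ay; exists (e' y); rewrite /= ?e'K// mem_index_enum mem_set.
  by case=> i /andP[_ /set_mem h] ->.
have nuE A : nu A = (\sum_(i < n.+1 | e i \in A) p i)%:E.
  rewrite -sumEFin {1}(AE A) measure_bigsetU_ord_cond//=; last first.
    by move=> i j _ _ [x [/= -> /(can_inj eK)]].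
  by apply: eq_bigr => i _; rewrite fineK// fin_num_measure.
have p_ge0 i : 0 <= p i by exact: fine_ge0.
have p_sum : \sum_i p i = 1.
  apply: EFin_inj; rewrite -(probability_setT nu) nuE.
  by congr EFin; apply: eq_bigl => i; rewrite in_setT.
exists (e \o quantile p).
have qE A : (e \o quantile p) @^-1` A
    = \big[setU/set0]_(i < n.+1 | e i \in A) (quantile p @^-1` [set i]).
  rewrite -bigcup_seq_cond; apply/seteqP; split => u /=.
    by move=> h; exists (quantile p u) => //=; rewrite mem_index_enum mem_set.
  by case=> i /andP[_ /set_mem h] ->.
split=> A; rewrite qE.
  apply: bigsetU_measurable => i _; exact: measurable_quantile.
rewrite measure_bigsetU_ord//=; last 2 first.
- by move=> i; exact: measurable_quantile.
- by move=> i j _ _ [v [<- <-]].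
rewrite nuE -sumEFin; apply: eq_bigr => i _; exact: uniform_quantile.
Qed.

Section Realization.
Variables (R : realType) (m : nat) (mu : probability (cube m.+1) R).
Local Notation RR := (measurableTypeR R).

Definition unif01 : probability RR R := uniform_prob (@ltr01 R).

(** The three independent coordinates drive the choice of the target, of the
    starting point and of the steps. *)
Definition joint_law : probability (RR * (cube m.+1 * RR))%type R :=
  (unif01 \x (mu \x unif01))%E.

Definition position (t : nat) (w : RR * (cube m.+1 * RR)) : cube m.+1 :=
  walk t w.2.1 w.2.2.

Lemma measurable_walk_from t (A : set (cube m.+1)) :
  measurable [set z : cube m.+1 * RR | A (walk t z.1 z.2)].
Proof.
rewrite (_ : [set _ | _] = \big[setU/set0]_(x : cube m.+1)
    ([set x] `*` (walk t x @^-1` A))).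
  apply: bigsetU_measurable => x _.
  by apply: measurableX => //; exact: measurable_walk.
rewrite -bigcup_seq; apply/seteqP; split => -[x v] /=.
  by move=> h; exists x => //=; exact: mem_index_enum.
by case=> y _ [/= ->].
Qed.

Lemma measurable_position t : measurable_fun setT (position t).
Proof.
by move=> _ A _; exact: (measurable_snd measurableT _ (measurable_walk_from t A)).
Qed.

HB.instance Definition _ t :=
  isMeasurableFun.Build _ _ _ _ (position t) (measurable_position t).

Definition seed : RR * (cube m.+1 * RR) -> R := fst.

HB.instance Definition _ :=
  isMeasurableFun.Build _ _ _ _ seed measurable_fst.

Definition srw_process (t : nat) :
    {mfun (RR * (cube m.+1 * RR))%type >-> cube m.+1} :=
  position t.
Definition srw_seed : {mfun (RR * (cube m.+1 * RR))%type >-> R} := seed.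

Lemma joint_lawX (C : set RR) (D : set (cube m.+1 * RR)) :
  measurable C -> measurable D ->
  joint_law (C `*` D) = (unif01 C * (mu \x unif01) D)%E.
Proof. exact: product_measure1E. Qed.

Lemma joint_lawXX (C D : set RR) (A : set (cube m.+1)) :
  measurable C -> measurable D ->
  joint_law (C `*` (A `*` D)) = (unif01 C * (mu A * unif01 D))%E.
Proof.
move=> mC mD; rewrite joint_lawX//; last exact: measurableX.
by rewrite product_measure1E.
Qed.

(** A path event is a rectangle: the starting point is prescribed, and so are the
    first steps of the walk driven by the last coordinate. *)
Lemma is_srw_process : is_srw joint_law mu srw_process.
Proof.
split=> [A|t xs].
  rewrite /distribution /pushforward.
  rewrite (_ : _ @^-1` _ = setT `*` (A `*` setT)); last first.
    by apply/seteqP; split => -[u [x v]] //= -[_ []].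
  rewrite joint_lawXX//.
  by rewrite !probability_setT mul1e mule1.
have E s : joint_law (path_event srw_process s xs)
    = (mu [set xs 0%N] * (\prod_(0 <= r < s) srw_kernel R (xs r) (xs r.+1))%:E)%E.
  have -> : path_event srw_process s xs =
      setT `*` ([set xs 0%N] `*` walk_path (xs 0%N) s xs).
    apply/seteqP; split => -[u [x v]] /=.
      move=> h; have /= x0 := h 0%N isT; split => //; split => //= r rs.
      by rewrite -x0; exact: (h r).
    by case=> _ [/= ->].
  have mw := @measurable_walk_path R m (xs 0%N) s xs.
  rewrite joint_lawXX//.
  rewrite probability_setT mul1e; congr (_ * _)%E; exact: uniform_walk_path.
by rewrite !E big_nat_recr//= EFinM muleA.
Qed.

(** The process is a function of the last two coordinates, so its events are
    cylinders over them. *)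
Lemma independent_uniform_seed : independent_uniform joint_law srw_process srw_seed.
Proof.
split=> [B mB|A B].
  rewrite /distribution /pushforward.
  rewrite (_ : _ @^-1` _ = B `*` setT); last first.
    by apply/seteqP; split => -[u w] //= -[].
  by rewrite joint_lawX// probability_setT mule1.
case=> C mC <-; rewrite setTI => sB.
have [D mD <-] : g_sigma_algebra_preimage (@snd RR (cube m.+1 * RR)%type) B.
  apply: sB; split; first exact/sigma_algebra_preimage/sigma_algebra_measurable.
  move=> _ [t _ [D _ <-]]; rewrite setTI.
  by exists [set z | D (walk t z.1 z.2)];
    [exact: measurable_walk_from|rewrite setTI].
rewrite setTI.
have -> : srw_seed @^-1` C = C `*` setT.
  by apply/seteqP; split => -[u w] //= -[].
have -> : snd @^-1` D = (setT `*` D : set (RR * (cube m.+1 * RR))).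
  by apply/seteqP; split => -[u w] //= -[].
rewrite -setXI setTI setIT !joint_lawX//.
by rewrite !probability_setT mule1 mul1e.
Qed.

End Realization.

(** * First times and their tail sums *)

Section FirstTime.
Variable b : nat -> bool.

Definition first_time : option nat :=
  if pselect (exists t, b t) is left ex then Some (ex_minn ex) else None.

Lemma first_time_Some t : first_time = Some t ->
  b t /\ forall s, (s < t)%N -> ~~ b s.
Proof.
rewrite /first_time; case: pselect => // ex [<-]; case: ex_minnP => k bk kmin.
by split=> // s; apply: contraTN => /kmin; rewrite leqNgt.
Qed.

Lemma first_time_None : first_time = None -> forall s, ~~ b s.
Proof.
rewrite /first_time; case: pselect => // nex _ s; apply/negP => bs.
by apply: nex; exists s.
Qed.

Lemma first_time_le t :
  (exists2 s, first_time = Some s & (s <= t)%N) <-> exists2 s, (s <= t)%N & b s.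
Proof.
split=> [[s /first_time_Some[bs _] st]|[s st bs]]; first by exists s.
case E : first_time => [k|]; last by have := first_time_None E s; rewrite bs.
exists k => //; rewrite (leq_trans _ st)// leqNgt; apply/negP => sk.
by have [_ /(_ s sk)] := first_time_Some E; rewrite bs.
Qed.

(** The tail-sum formula [T = \sum_n 1_(T > n)], which also holds when [T] is
    infinite. *)
Lemma first_time_tail_sum (R : realType) :
  (if first_time is Some t then t%:R%:E else +oo)%E
  = (\sum_(n <oo) (\1_[set k | forall s, (s <= k)%N -> ~~ b s] n : R)%:E)%E.
Proof.
set S := [set k | _].
case E : first_time => [t|].
  have [bt bN] := first_time_Some E.
  rewrite (@nneseries_split _ _ 0%N t); last by move=> k _; rewrite lee_fin.
  rewrite add0n [X in (_ + X)%E]eseries0 ?adde0; last first.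
    by move=> k tk _; rewrite indicE memNset//= => /(_ t tk); rewrite bt.
  rewrite big_mkord (eq_bigr (fun=> 1%E)).
    by rewrite sumEFin sumr_const card_ord.
  move=> i _; rewrite indicE mem_set//= => s si; apply: bN.
  exact: leq_ltn_trans si _.
have bN := first_time_None E.
apply/esym/eqyP => A A0.
have h0 n : (0 <= (\1_S n : R)%:E)%E by rewrite lee_fin.
apply: (le_trans _ (nneseries_lim_ge (Num.truncn A).+1 _)); last by [].
rewrite big_mkord (eq_bigr (fun=> 1%E)); last by move=> i _; rewrite indicE mem_set.
by rewrite sumEFin sumr_const card_ord lee_fin ltW// truncnS_gt.
Qed.

End FirstTime.

Section ProductBound.
Context d1 d2 (T1 : measurableType d1) (T2 : measurableType d2) (R : realType).
Variables (P1 : probability T1 R) (P2 : probability T2 R).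
Local Open Scope ereal_scope.

(** A bound which holds conditionally on the first coordinate holds on average;
    [N] is kept finite so that only finite sums are exchanged with integrals. *)
Lemma sum_product_measure_le (A : nat -> set (T1 * T2)) (N : nat) (C : R) :
  (forall n, measurable (A n)) ->
  (forall x, \sum_(n < N) P2 [set y | A n (x, y)] <= C%:E) ->
  \sum_(n < N) (P1 \x P2) (A n) <= C%:E.
Proof.
move=> mA AC.
rewrite /product_measure1 -ge0_integral_sum//=; last first.
  by move=> n; exact: measurable_fun_xsection.
have -> : C%:E = \int[P1]_x cst C%:E x.
  by rewrite integral_cst// [X in (_ * X)%E](probability_setT P1) mule1.
apply: ge0_le_integral => //=.
- by move=> x _; exact: sume_ge0.
- apply: emeasurable_sum => n; exact: measurable_fun_xsection.
- move=> x _; apply: le_trans (AC x); apply: lee_sum => n _.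
  by rewrite xsectionE.
Qed.

End ProductBound.

(** * Hitting a random target *)

Section HittingTime.
Context (R : realType) (d : nat) (disp : measure_display).
Context (Omega : measurableType disp) (P : probability Omega R).
Variables (X : nat -> {mfun Omega >-> cube d}) (U : {mfun Omega >-> R}).
Variable q : R -> cube d.
Hypothesis mq : forall A, measurable (q @^-1` A).

Definition hitting_time (w : Omega) : option nat :=
  first_time (fun t => X t w == q (U w)).

Definition not_hit (n : nat) : set Omega :=
  [set w | forall s, (s <= n)%N -> X s w != q (U w)].

Lemma hitting_time_le t :
  [set w | exists2 s, hitting_time w = Some s & (s <= t)%N]
  = \big[setU/set0]_(i < t.+1) \big[setU/set0]_(y : cube d)
      (X i @^-1` [set y] `&` U @^-1` (q @^-1` [set y])).
Proof.
apply/seteqP; split => w.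
  move=> /first_time_le[s st /eqP e].
  rewrite -bigcup_seq; exists (Ordinal (st : (s < t.+1)%N)).
    exact: mem_index_enum.
  by rewrite -bigcup_seq; exists (q (U w)); first exact: mem_index_enum.
rewrite -bigcup_seq => -[i _]; rewrite -bigcup_seq => -[y _ [/= Xy qy]].
by apply/first_time_le; exists (i : nat); [rewrite -ltnS|apply/eqP; rewrite Xy qy].
Qed.

(** Whether the target has been hit by time [t] is decided by comparing it with
    finitely many positions, over finitely many values. *)
Lemma hitting_time_stopping : is_stopping_time U X hitting_time.
Proof.
move=> t; rewrite hitting_time_le /filtration.
set G := _ `|` _.
change (measurable (\big[setU/set0]_(i < t.+1) \big[setU/set0]_(y : cube d)
      (X i @^-1` [set y] `&` U @^-1` (q @^-1` [set y]))
  : set (g_sigma_algebraType G))).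
apply: bigsetU_measurable => i _; apply: bigsetU_measurable => y _.
apply: measurableI; apply: sub_sigma_algebra.
  right; exists (i : nat); first by rewrite /= -ltnS.
  by exists [set y] => //; rewrite setTI.
by left; exists (q @^-1` [set y]); [exact: mq|rewrite setTI].
Qed.

Lemma measurable_hitting_time_le t :
  measurable [set w | exists2 s, hitting_time w = Some s & (s <= t)%N].
Proof.
rewrite hitting_time_le.
apply: bigsetU_measurable => i _; apply: bigsetU_measurable => y _.
apply: measurableI; rewrite -[_ @^-1` _]setTI; exact: measurable_funP.
Qed.

Lemma not_hitE n :
  not_hit n = ~` [set w | exists2 s, hitting_time w = Some s & (s <= n)%N].
Proof.
apply/seteqP; split => w /=.
  by move=> h /first_time_le[s sn]; apply/negP; exact: h.
by move=> h s sn; apply/negP => e; apply/h/first_time_le; exists s.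
Qed.

Lemma measurable_not_hit n : measurable (not_hit n).
Proof. rewrite not_hitE; exact/measurableC/measurable_hitting_time_le. Qed.

Variable C : R.
Hypothesis sum_not_hit_le : forall N, (\sum_(n < N) P (not_hit n) <= C%:E)%E.

Lemma expected_hitting_time_le : (expected_time P hitting_time <= C%:E)%E.
Proof.
rewrite /expected_time.
rewrite (eq_integral
  (fun w => \sum_(n <oo) (\1_(not_hit n) w : R)%:E)%E); last first.
  move=> w _; rewrite /hitting_time first_time_tail_sum.
  by apply: eq_eseriesr => n _; rewrite !indicE.
rewrite integral_nneseries//; last first.
  move=> n; apply/measurable_EFinP/measurable_indic.
  exact: measurable_not_hit.
apply: lime_le.
  by apply: is_cvg_nneseries => n _ _; apply: integral_ge0 => w _; rewrite lee_fin.
apply: nearW => N; rewrite big_mkord; apply: le_trans (sum_not_hit_le N).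
apply: lee_sum => n _; rewrite integral_indic ?setIT//; exact: measurable_not_hit.
Qed.

Lemma never_hitE :
  [set w | hitting_time w = None] = \bigcap_n not_hit n.
Proof.
apply/seteqP; split => w /=.
  by move=> /first_time_None h n _ s _; exact: h.
move=> h; case E : (hitting_time w) => [t|//].
by have [bt _] := first_time_Some E; have := h t I t (leqnn t); rewrite bt.
Qed.

Lemma measurable_never_hit : measurable [set w | hitting_time w = None].
Proof.
rewrite never_hitE; apply: bigcap_measurable; first by exists 0%N.
by move=> n _; exact: measurable_not_hit.
Qed.

(** The target is missed up to every time [n < N] with probability at least that
    of missing it forever, so [N] times the latter is bounded uniformly. *)
Lemma never_hit0 : P [set w | hitting_time w = None] = 0%E.
Proof.
set E := [set w | _].
have mE := measurable_never_hit.
have PE : P E = (fine (P E))%:E by rewrite fineK// fin_num_measure.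
set p := fine (P E) in PE.
have p0 : 0 <= p by exact: fine_ge0.
have le N : (N%:R * p <= C).
  rewrite -lee_fin EFinM -PE; apply: le_trans (sum_not_hit_le N).
  have -> : (N%:R%:E * P E = \sum_(n < N) P E)%E.
    by rewrite PE -EFinM sumEFin sumr_const card_ord mulr_natl.
  apply: lee_sum => n _; apply: le_measure; rewrite ?inE//.
    exact: measurable_not_hit.
  by rewrite /E never_hitE; exact: bigcap_inf.
rewrite PE; congr EFin; apply/eqP; rewrite eq_le p0 andbT leNgt; apply/negP => pgt.
have := le (Num.truncn (C / p)).+1; rewrite leNgt => /negP; apply.
by rewrite -ltr_pdivrMr// truncnS_gt.
Qed.

Lemma hitting_time_ae_finite : ae_finite P hitting_time.
Proof.
exists [set w | hitting_time w = None]; split.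
- exact: measurable_never_hit.
- exact: never_hit0.
- by move=> w /= /contrapT.
Qed.

Variable nu : probability (cube d) R.
Hypothesis target_law : forall A, P (U @^-1` (q @^-1` A)) = nu A.

(** At the hitting time the walk sits at the target, which has law [nu]. *)
Lemma hitting_time_law : stops_with_law P X hitting_time nu.
Proof.
move=> A; rewrite -target_law.
set E := [set w | hitting_time w = None].
have mqU : measurable (U @^-1` (q @^-1` A)).
  by rewrite -[_ @^-1` _]setTI; exact: measurable_funP.
have mE : measurable E by exact: measurable_never_hit.
have -> : [set w | exists2 t, hitting_time w = Some t & A (X t w)]
    = U @^-1` (q @^-1` A) `\` E.
  apply/seteqP; split => w.
    case=> t Tt; have [/eqP -> _] := first_time_Some Tt => Aq.
    by split; [exact: Aq|rewrite /E /= Tt].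
  case=> Aq; rewrite /E /=; case Tt : (hitting_time w) => [t|//] _.
  by exists t => //; have [/eqP -> _] := first_time_Some Tt.
rewrite measureD//; last by rewrite -ge0_fin_numE// fin_num_measure.
rewrite [X in (_ - X)%E](_ : _ = 0%E) ?sube0//.
by apply: subset_measure0 (never_hit0) => //; exact: measurableI.
Qed.

End HittingTime.

(** * The bound on the access time *)

(** Conditionally on the target and on the starting point, the tail sums of the
    hitting time are at most [hitting_bound] at the distance between them, hence
    at most its value at the antipode. *)
Lemma access_time_le (R : realType) m (mu nu : probability (cube m.+1) R) :
  (access_time mu nu <= (hitting_bound R m m.+1)%:E)%E.
Proof.
have [q [mq qE]] := sampling_exists nu.
have H N : (\sum_(n < N) joint_law mu
    (not_hit (srw_process R m) (srw_seed R m) q n)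
      <= (hitting_bound R m m.+1)%:E)%E.
  apply: (@sum_product_measure_le _ _ _ _ R (unif01 R) (mu \x unif01 R)%E) => [n|u].
    exact: measurable_not_hit.
  have E n x :
      [set v | not_hit (srw_process R m) (srw_seed R m) q n (u, (x, v))]
      = walk_avoids x (q u) n.
    by apply/seteqP; split => v h s sn; apply/eqP; exact: h.
  have M n : measurable
      [set z | not_hit (srw_process R m) (srw_seed R m) q n (u, z)].
    have := measurable_xsection u
      (measurable_not_hit (srw_process R m) (srw_seed R m) mq n).
    by rewrite xsectionE.
  have := @sum_product_measure_le _ _ _ _ R mu (unif01 R)
    (fun n => [set z | not_hit (srw_process R m) (srw_seed R m) q n (u, z)]) N
    (hitting_bound R m m.+1) M.
  apply => x.
  rewrite (eq_bigr (fun n : 'I_N => (survival R n x (q u))%:E)); last first.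
    by move=> n _; rewrite E; exact: uniform_walk_avoids.
  rewrite sumEFin lee_fin (le_trans (sum_survival_le _ _ _ _))//.
  by rewrite hitting_bound_homo// hamming_le.
apply: (@le_trans _ _ (expected_time (joint_law mu)
    (hitting_time (srw_process R m) (srw_seed R m) q))); last first.
  exact: expected_hitting_time_le.
apply: ereal_inf_lbound.
do 6 eexists; split; last reflexivity.
- exact: is_srw_process.
- exact: independent_uniform_seed.
- exact: hitting_time_stopping.
- split; first exact: hitting_time_ae_finite H.
  apply: hitting_time_law H _ _ => // A.
  by rewrite -qE; exact: (independent_uniform_seed mu).1 _ (mq A).
Qed.

Theorem corollary2p1 (R : realType) :
  exists eps : nat -> R,
    (eps d @[d --> \oo] --> 0) /\
    (forall d : nat, (0 < d)%N ->
     forall mu nu : probability (cube d) R,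
       (access_time mu nu <= ((1 + eps d) * 2 ^+ d)%:E)%E).
Proof.
exists (fun d => 13 / d%:R); split.
  rewrite -cvg_shiftS.
  have := cvgM (cvg_cst (13 : R)) (@cvg_harmonic R).
  by rewrite mulr0 => h; exact: h.
move=> [//|m] _ mu nu; apply: le_trans (access_time_le mu nu) _.
by rewrite lee_fin hitting_bound_asymp.
Qed.
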